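(* Let $r,b>0$, $h\ge 0$, and let $(u,v)(t,x)=(\phi,\theta)(\nu\cdot x+ct)$, $|\nu|=1$, $\phi>0$, be a wavefront with speed $c$ connecting $(0,1)$ with $(1,0)$ for the system $$u_t(t,x)=\Delta u(t,x)+u(t,x)(1-u(t,x)-rv(t-h,x)),\qquad v_t(t,x)=\Delta v(t,x)-bu(t,x)v(t,x).$$ Set $\psi(t):=1-\theta(t-ch)$. [A] Let $r\in(0,1)$, and let $K\ge 1$, $L\in(0,1]$ satisfy $K\ge b/(1-r)\ge L$. Then $$L\phi(t-ch)<\psi(t)<K\phi(t),\qquad t\in\mathbb{R}.$$ If $b+r=1$, then $\phi(t-ch)\le\psi(t)\le\phi(t)$ for all $t\in\mathbb{R}$. Hence, if $h=0$ (and $b+r=1$), then $\phi\equiv\psi$. [B] Let $r\ge 1$. Then $\psi(t)>\phi(t)$ for all $t\in\mathbb{R}$. [C] Let $r\in(0,1]$. Then $\psi^2(t)<M\phi(t)$ for all $t\in\mathbb{R}$, where $M:=\max\{1,2b\}$.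
   Context: A wavefront with speed $c$ connecting $(0,1)$ with $(1,0)$ is a solution of the form $(u,v)(t,x)=(\phi,\theta)(\nu\cdot x+ct)$, $|\nu|=1$, with $(\phi,\theta)(-\infty)=(0,1)$ and $(\phi,\theta)(+\infty)=(1,0)$. Equivalently, for $t\in\mathbb{R}$, $$\phi''(t)-c\phi'(t)+\phi(t)(1-\phi(t)-r\theta(t-ch))=0,\qquad \theta''(t)-c\theta'(t)-b\phi(t)\theta(t)=0 .$$
   Formalization: In [A] the strict lower bound is not claimed when h=0, b+r=1, L=1, nor the strict upper bound when h=0, b+r=1, K=1: there φ≡ψ, as the last sentence of [A] says, so the strict inequalities fail (e.g. a KPP front φ with θ=1-φ). *)

(* Defs.v *)
From mathcomp Require Import all_boot all_order all_algebra.
From mathcomp Require Import all_classical all_reals all_analysis.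

Set Implicit Arguments.
Unset Strict Implicit.
Unset Printing Implicit Defensive.

Import Order.TTheory GRing.Theory Num.Theory.
Import numFieldNormedType.Exports.

Local Open Scope classical_set_scope.
Local Open Scope ring_scope.

Definition dotv (R : realType) (n : nat) (x y : 'rV[R]_n) : R :=
  \sum_(i < n) x ord0 i * y ord0 i.

(* The norm `|x| that the library puts on 'rV[R]_n is the sup norm, hence a
   separate definition of the Euclidean one. *)
Definition enorm (R : realType) (n : nat) (x : 'rV[R]_n) : R :=
  Num.sqrt (dotv x x).

Definition evec (R : realType) (n : nat) (i : 'I_n) : 'rV[R]_n :=
  delta_mx ord0 i.

Definition laplacian (R : realType) (n : nat) (f : 'rV[R]_n -> R)
    (x : 'rV[R]_n) : R :=
  \sum_(i < n) 'D_(evec R i) ('D_(evec R i) f) x.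

(* 'D_v and derive1 are total and return a junk value where the derivative does not
   exist, so the existence of every derivative entering the equations is
   required explicitly. *)
Definition has_time_derivative (R : realType) (n : nat)
    (w : R -> 'rV[R]_n -> R) : Prop :=
  forall t x, derivable (fun s : R => w s x) t 1.

Definition has_pure_second_derivatives (R : realType) (n : nat)
    (w : R -> 'rV[R]_n -> R) : Prop :=
  forall t x (i : 'I_n),
    derivable (w t) x (evec R i) /\
    derivable ('D_(evec R i) (w t)) x (evec R i).

Record classical_solution (R : realType) (n : nat) (r b h : R)
    (u v : R -> 'rV[R]_n -> R) : Prop := ClassicalSolution {
  sol_u_t  : has_time_derivative u;
  sol_v_t  : has_time_derivative v;
  sol_u_xx : has_pure_second_derivatives u;
  sol_v_xx : has_pure_second_derivatives v;
  sol_eq_u : forall t x,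
    derive1 (fun s : R => u s x) t =
      laplacian (u t) x + u t x * (1 - u t x - r * v (t - h) x);
  sol_eq_v : forall t x,
    derive1 (fun s : R => v s x) t = laplacian (v t) x - b * u t x * v t x
}.

Definition travelling (R : realType) (n : nat) (nu : 'rV[R]_n) (c : R)
    (p : R -> R) : R -> 'rV[R]_n -> R :=
  fun t x => p (dotv nu x + c * t).

Record wavefront (R : realType) (n : nat) (r b h : R) (nu : 'rV[R]_n) (c : R)
    (phi theta : R -> R) : Prop := Wavefront {
  wf_direction : enorm nu = 1;
  wf_solution  :
    classical_solution r b h (travelling nu c phi) (travelling nu c theta);
  wf_phi_ninfty   : phi s @[s --> -oo%R] --> (0 : R);
  wf_theta_ninfty : theta s @[s --> -oo%R] --> (1 : R);
  wf_phi_pinfty   : phi s @[s --> +oo%R] --> (1 : R);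
  wf_theta_pinfty : theta s @[s --> +oo%R] --> (0 : R)
}.

(* Main.v *)
(* A front of the system is a pair (phi, theta) solving the profile equations
   phi'' - c phi' + phi (1 - phi - r theta(. - ch)) = 0 and
   theta'' - c theta' - b phi theta = 0. The equation for theta makes theta decrease
   from 1 to 0 and, by convexity, forces c > 0; the equation for phi then makes phi
   increase. Each inequality says that some w, among K phi - psi,
   psi - L phi(. - ch), psi - phi and M phi - psi^2, is positive. Since w has
   nonnegative limits, it suffices that w'' < 0 at every critical point where
   w <= 0, and there w'' - c w' is minus a sum of nonnegative terms, one of which
   is positive. *)
Require Import Defs.
From mathcomp Require Import all_boot all_order all_algebra.
From mathcomp Require Import all_classical all_reals all_analysis.
From mathcomp Require Import ring lra.
Set Implicit Arguments.
Unset Strict Implicit.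
Unset Printing Implicit Defensive.
Import Order.TTheory GRing.Theory Num.Theory.
Import numFieldNormedType.Exports.
Local Open Scope ring_scope.

(** * Extrema of functions on the line *)

Definition has_derivative (R : realType) (f f' : R -> R) : Prop :=
  forall t, is_derive t (1 : R) f (f' t).

Lemma has_derivative_continuous (R : realType) (f f' : R -> R) :
  has_derivative f f' -> continuous f.
Proof.
by move=> df t; apply/differentiable_continuous/derivable1_diffP; case: (df t).
Qed.

Lemma mean_value (R : realType) (f f' : R -> R) (x y : R) :
  has_derivative f f' -> x < y ->
  exists z, [/\ x < z, z < y & f y - f x = f' z * (y - x)].
Proof.
move=> df xy.
have [|z] := MVT xy (fun u _ => df u).
  exact/continuous_subspaceT/has_derivative_continuous/df.
by rewrite in_itv /= => /andP[xz zy] fz; exists z.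
Qed.

Lemma has_derivativeN (R : realType) (f f' : R -> R) :
  has_derivative f f' -> has_derivative (fun t => - f t) (fun t => - f' t).
Proof. by move=> df t; have := df t => dft; apply: is_derive_eq. Qed.

Lemma has_derivativeD (R : realType) (f f' g g' : R -> R) :
  has_derivative f f' -> has_derivative g g' ->
  has_derivative (fun t => f t + g t) (fun t => f' t + g' t).
Proof.
by move=> df dg t; have := df t; have := dg t => dgt dft; apply: is_derive_eq.
Qed.

Lemma has_derivativeM (R : realType) (f f' g g' : R -> R) :
  has_derivative f f' -> has_derivative g g' ->
  has_derivative (fun t => f t * g t) (fun t => f' t * g t + f t * g' t).
Proof.
move=> df dg t; have := df t; have := dg t => dgt dft; apply: is_derive_eq.
by rewrite addrC mulrC.
Qed.

Lemma has_derivative_cst (R : realType) (k : R) :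
  has_derivative (fun=> k) (fun=> 0).
Proof. by move=> t; apply: is_derive_cst. Qed.

Lemma has_derivative_shift (R : realType) (f f' : R -> R) (d : R) :
  has_derivative f f' -> has_derivative (fun t => f (t - d)) (fun t => f' (t - d)).
Proof.
move=> df t; rewrite -[f' _]mulr1; apply: (@is_derive1_comp _ f) (df _) _.
exact: is_derive_shift.
Qed.

Lemma has_derivative_eq (R : realType) (f f' g' : R -> R) :
  has_derivative f f' -> f' =1 g' -> has_derivative f g'.
Proof. by move=> df fg t; rewrite -fg; apply: df. Qed.

Lemma negative_slope_right (R : realType) (f : R -> R) (t l : R) :
  is_derive t (1 : R) f l -> l < 0 ->
  exists2 e, 0 < e & forall s, t < s -> s < t + e -> f s < f t.
Proof.
move=> [df dl] l0.
have : ((fun k : R => k^-1 *: ((f \o shift t) (k *: (1 : R)) - f t)) @ 0^' --> l)%classic.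
  by rewrite -dl; exact: df.
move=> /cvgr_lt /(_ 0 l0) [e /= e0 He]; exists e => // s ts ste.
have st0 : 0 < s - t by rewrite subr_gt0.
have := He (s - t).
rewrite /ball_ /= sub0r normrN gtr0_norm // ltrBlDl lt_neqAle.
rewrite /= [_ *: 1]mulr1 subrK => /(_ _ _); rewrite /GRing.scale /=.
rewrite -lt_neqAle => /(_ ste); rewrite gt_eqF // => /(_ isT).
by rewrite pmulr_rlt0 ?invr_gt0 // subr_lt0.
Qed.

(** No continuity of [f2] is at hand, so a negative [f2 t] is used only through [f1] being negative
    just to the right of [t]; by the mean value theorem [f] then falls below [f t]. *)
Lemma second_derivative_at_min (R : realType) (f f1 f2 : R -> R) (x y t : R) :
  has_derivative f f1 -> has_derivative f1 f2 -> x < t -> t < y ->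
  (forall s, x < s -> s < y -> f t <= f s) -> f1 t = 0 /\ 0 <= f2 t.
Proof.
move=> df df1 xt ty fmin.
have txy : t \in `]x, y[%R by rewrite in_itv /= xt.
have f1t : f1 t = 0.
  have D0 : is_derive t (1 : R) f 0.
    apply: (derive1_at_min (ltW (lt_trans xt ty))) txy _ => s.
      by move=> _; case: (df s).
    by rewrite in_itv /= => /andP[xs sy]; apply: fmin.
  by case: (df t) => _ <-; case: D0.
split=> //; rewrite leNgt; apply/negP => f2t.
have [e e0 He] := negative_slope_right (df1 t) f2t.
pose s := Num.min (t + e / 2) ((t + y) / 2).
have ts : t < s by rewrite lt_min; apply/andP; split; lra.
have se : s < t + e by rewrite gt_min; apply/orP; left; lra.
have sy : s < y by rewrite gt_min; apply/orP; right; lra.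
have [z [tz zs fz]] := mean_value df ts.
have := fmin s (lt_trans xt ts) sy.
have := He z tz (lt_trans zs se); rewrite f1t => f1z.
rewrite -subr_ge0 fz pmulr_lge0 ?subr_gt0 // => ?; lra.
Qed.

Lemma second_derivative_at_max (R : realType) (f f1 f2 : R -> R) (x y t : R) :
  has_derivative f f1 -> has_derivative f1 f2 -> x < t -> t < y ->
  (forall s, x < s -> s < y -> f s <= f t) -> f1 t = 0 /\ f2 t <= 0.
Proof.
move=> df df1 xt ty fmax.
have [] := second_derivative_at_min (has_derivativeN df)
  (has_derivativeN df1) xt ty.
  by move=> s xs sy; rewrite lerN2 fmax.
by move=> /eqP; rewrite oppr_eq0 oppr_ge0 => /eqP.
Qed.

Lemma lt_lim_pinfty (R : realType) (f : R -> R) (l y : R) :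
  (f s @[s --> +oo%R] --> l)%classic -> y < l -> exists N, forall s, N < s -> y < f s.
Proof. by move=> /cvgr_gt + yl => /(_ _ yl) [N [_ HN]]; exists N. Qed.

Lemma gt_lim_pinfty (R : realType) (f : R -> R) (l y : R) :
  (f s @[s --> +oo%R] --> l)%classic -> l < y -> exists N, forall s, N < s -> f s < y.
Proof. by move=> /cvgr_lt + yl => /(_ _ yl) [N [_ HN]]; exists N. Qed.

Lemma lt_lim_ninfty (R : realType) (f : R -> R) (l y : R) :
  (f s @[s --> -oo%R] --> l)%classic -> y < l -> exists N, forall s, s < N -> y < f s.
Proof. by move=> /cvgr_gt + yl => /(_ _ yl) [N [_ HN]]; exists N. Qed.

Lemma gt_lim_ninfty (R : realType) (f : R -> R) (l y : R) :
  (f s @[s --> -oo%R] --> l)%classic -> l < y -> exists N, forall s, s < N -> f s < y.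
Proof. by move=> /cvgr_lt + yl => /(_ _ yl) [N [_ HN]]; exists N. Qed.

Lemma continuous_min (R : realType) (f : R -> R) (x y : R) :
  continuous f -> x <= y ->
  exists t, [/\ x <= t, t <= y & forall s, x <= s -> s <= y -> f t <= f s].
Proof.
move=> cf xy; have [t] := EVT_min xy (continuous_subspaceT cf).
rewrite in_itv /= => /andP[xt ty] tmin; exists t; split=> // s xs sy.
by apply: tmin; rewrite in_itv /= xs.
Qed.

(** Far to the right [f] exceeds [f y], so a minimum over a compact interval containing [y] is one
    over the half line. *)
Lemma min_right_half_line (R : realType) (f : R -> R) (l x y : R) :
  continuous f -> (f s @[s --> +oo%R] --> l)%classic -> x <= y -> f y < l ->
  exists t, [/\ x <= t, f t <= f y & forall s, x <= s -> f t <= f s].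
Proof.
move=> cf fl xy yl.
have [N HN] := lt_lim_pinfty fl yl.
have yN : y <= Num.max N y by rewrite le_max lexx orbT.
have [t [xt tN tmin]] := continuous_min cf (le_trans xy yN).
exists t; split=> // [|s xs]; first exact: tmin.
have [sN|Ns] := leP s (Num.max N y); first exact: tmin.
apply: le_trans (tmin y xy yN) (ltW (HN s _)).
by apply: le_lt_trans Ns; rewrite le_max lexx.
Qed.

Lemma min_left_half_line (R : realType) (f : R -> R) (l x y : R) :
  continuous f -> (f s @[s --> -oo%R] --> l)%classic -> y <= x -> f y < l ->
  exists t, [/\ t <= x, f t <= f y & forall s, s <= x -> f t <= f s].
Proof.
move=> cf fl yx yl.
have [N HN] := lt_lim_ninfty fl yl.
have Ny : Num.min N y <= y by rewrite ge_min lexx orbT.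
have [t [Nt tx tmin]] := continuous_min cf (le_trans Ny yx).
exists t; split=> // [|s sx]; first exact: tmin.
have [Ns|sN] := leP (Num.min N y) s; first exact: tmin.
apply: le_trans (tmin y Ny yx) (ltW (HN s _)).
by apply: (lt_le_trans sN); rewrite ge_min lexx.
Qed.

Lemma max_right_half_line (R : realType) (f : R -> R) (l x y : R) :
  continuous f -> (f s @[s --> +oo%R] --> l)%classic -> x <= y -> l < f y ->
  exists t, [/\ x <= t, f y <= f t & forall s, x <= s -> f s <= f t].
Proof.
move=> cf fl xy ly.
have [||//||t [xt ty tmin]] := @min_right_half_line _ (fun s => - f s) (- l) x y.
- by move=> s; apply: continuousN; exact: cf.
- exact: cvgN.
- by rewrite ltrN2.
exists t; split=> // [|s xs]; first by rewrite -lerN2.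
by rewrite -lerN2 tmin.
Qed.

Lemma max_left_half_line (R : realType) (f : R -> R) (l x y : R) :
  continuous f -> (f s @[s --> -oo%R] --> l)%classic -> y <= x -> l < f y ->
  exists t, [/\ t <= x, f y <= f t & forall s, s <= x -> f s <= f t].
Proof.
move=> cf fl yx ly.
have [||//||t [xt ty tmin]] := @min_left_half_line _ (fun s => - f s) (- l) x y.
- by move=> s; apply: continuousN; exact: cf.
- exact: cvgN.
- by rewrite ltrN2.
exists t; split=> // [|s xs]; first by rewrite -lerN2.
by rewrite -lerN2 tmin.
Qed.

Lemma continuous_global_min (R : realType) (f : R -> R) (l m y : R) :
  continuous f -> (f s @[s --> -oo%R] --> l)%classic ->
  (f s @[s --> +oo%R] --> m)%classic -> f y < l -> f y < m ->
  exists t, forall s, f t <= f s.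
Proof.
move=> cf fl fm yl ym.
have [t1 [_ _ min1]] := min_left_half_line cf fl (lexx y) yl.
have [t2 [_ _ min2]] := min_right_half_line cf fm (lexx y) ym.
have [t12|t21] := leP (f t1) (f t2).
- exists t1 => s; have [/min1//|/ltW/min2] := leP s y; exact: le_trans.
- exists t2 => s; have [/min1|/ltW/min2//] := leP s y.
  by apply: le_trans; apply: ltW.
Qed.

(** A negative value lies below both limits, so a global minimum is attained; if there is no
    negative value, any zero is a global minimum. Either way the second derivative there is
    nonnegative. *)
Lemma maximum_principle (R : realType) (f f1 f2 : R -> R) (l m : R) :
  has_derivative f f1 -> has_derivative f1 f2 ->
  (f s @[s --> -oo%R] --> l)%classic -> (f s @[s --> +oo%R] --> m)%classic ->
  0 <= l -> 0 <= m ->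
  (forall t, f t <= 0 -> f1 t = 0 -> f2 t < 0) -> forall t, 0 < f t.
Proof.
move=> df df1 fl fm l0 m0 nomin t; rewrite ltNge; apply/negP => ft.
have [u [fu umin]] : exists u, f u <= 0 /\ forall s, f u <= f s.
  case: (pselect (exists y, f y < 0)) => [[y y0]|H].
    have [u umin] := continuous_global_min
      (has_derivative_continuous df) fl fm (lt_le_trans y0 l0)
      (lt_le_trans y0 m0).
    by exists u; split=> //; apply: le_trans (umin y) (ltW y0).
  exists t; split=> // s; rewrite leNgt; apply/negP => st.
  by apply: H; exists s; exact: lt_le_trans st ft.
have ul : u - 1 < u by lra.
have ur : u < u + 1 by lra.
have [f1u] := second_derivative_at_min df df1 ul ur
  (fun s _ _ => umin s).
by rewrite leNgt (nomin u fu f1u).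
Qed.

(** This version serves [theta], whose equation gives a zero second derivative, not a negative one,
    at a critical zero. *)
Lemma maximum_principle_weak (R : realType) (f f1 f2 : R -> R) (l m : R) :
  has_derivative f f1 -> has_derivative f1 f2 ->
  (f s @[s --> -oo%R] --> l)%classic -> (f s @[s --> +oo%R] --> m)%classic ->
  0 <= l -> 0 <= m ->
  (forall t, f t < 0 -> f1 t = 0 -> f2 t < 0) -> forall t, 0 <= f t.
Proof.
move=> df df1 fl fm l0 m0 nomin t; rewrite leNgt; apply/negP => ft.
have [u umin] := continuous_global_min
  (has_derivative_continuous df) fl fm (lt_le_trans ft l0)
  (lt_le_trans ft m0).
have ul : u - 1 < u by lra.
have ur : u < u + 1 by lra.
have [f1u] := second_derivative_at_min df df1 ul ur
  (fun s _ _ => umin s).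
by rewrite leNgt (nomin u (le_lt_trans (umin t) ft) f1u).
Qed.

(** * From plane waves to the profile equations *)

(** Differentiating a plane wave along a coordinate differentiates its profile in the direction
    [nu ord0 i]; composing with an affine map rescales that direction to 1. *)
Lemma derivable_direction (R : realType) (p : R -> R) (s k : R) :
  k != 0 -> derivable p s k -> derivable p s 1.
Proof.
move=> k0 /derivable1P; set g := fun u : R => _ => dg.
have -> : p = g \o (fun y => (y - s) * k^-1).
  by apply/funext => y /=; rewrite /g [_ *: _]mulfVK // subrK.
pose q (y : R) := (y - s) * k^-1.
have dq : is_derive s (1 : R) q k^-1.
  have ds : is_derive s (1 : R) (fun y => y - s) 1 by exact: is_derive_shift.
  by apply: is_derive_eq; rewrite /= scaler0 add0r [LHS]mulr1.
have dg' : is_derive (q s) (1 : R) g ('D_1 g (q s)).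
  by apply/derivableP; rewrite /q subrr mul0r.
by case: (is_derive1_comp dg' dq).
Qed.

Lemma derive_direction (R : realType) (p : R -> R) (s k : R) :
  derivable p s 1 -> 'D_k p s = k * 'D_1 p s.
Proof.
move=> /derivable1_diffP dp; rewrite !deriveE //.
by rewrite -[X in 'd _ _ X = _]mulr1 [LHS]linearZ.
Qed.

Section PlaneWave.
Context (R : realType) (n : nat).
Implicit Types (nu x : 'rV[R]_n) (p : R -> R).

Lemma dotv_evec nu x (i : 'I_n) (k : R) :
  dotv nu (k *: evec R i + x) = k * nu ord0 i + dotv nu x.
Proof.
rewrite /dotv (eq_bigr (fun j =>
  k * (nu ord0 j * (j == i)%:R) + nu ord0 j * x ord0 j)); last first.
  by move=> j _; rewrite !mxE eqxx /=; ring.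
rewrite big_split /= -mulr_sumr (bigD1 i) //= eqxx mulr1 big1 ?addr0 //.
by move=> j /negbTE ->; rewrite mulr0.
Qed.

(** Since the difference quotients themselves agree, both derivability and the value of the
    derivative transfer, with no regularity assumed. *)
Lemma plane_wave_quotient nu (c t : R) p x i :
  (fun k : R => k^-1 *:
     ((travelling nu c p t \o shift x) (k *: evec R i) - travelling nu c p t x)) =
  (fun k : R => k^-1 *:
     ((p \o shift (dotv nu x + c * t)) (k *: nu ord0 i)
      - p (dotv nu x + c * t))).
Proof.
by apply/funext => k; rewrite /travelling /= dotv_evec -addrA.
Qed.

Lemma derivable_plane_wave nu (c t : R) p x i :
  derivable (travelling nu c p t) x (evec R i) =
  derivable p (dotv nu x + c * t) (nu ord0 i).
Proof. by rewrite /derivable plane_wave_quotient. Qed.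

Lemma derive_plane_wave nu (c t : R) p i :
  'D_(evec R i) (travelling nu c p t) =
  travelling nu c ('D_(nu ord0 i) p) t.
Proof.
by apply/funext => x; rewrite /derive plane_wave_quotient.
Qed.

Lemma dotv_unit_neq0 nu : dotv nu nu = 1 -> exists i, nu ord0 i != 0.
Proof.
move=> nu1; apply/existsP; apply: contraT => /existsPn nu0.
have := oner_neq0 R; rewrite -nu1 /dotv big1 ?eqxx // => i _.
by have /negPn/eqP -> := nu0 i; rewrite mul0r.
Qed.

(** Regularity of the profile is read off along one coordinate on which [nu] does not vanish; the
    Laplacian then produces the factor [dotv nu nu], which is 1. *)
Lemma plane_wave_derivatives nu (c : R) p :
  dotv nu nu = 1 -> has_pure_second_derivatives (travelling nu c p) ->
  exists p1 p2, [/\ has_derivative p p1, has_derivative p1 p2,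
    forall t x, laplacian (travelling nu c p t) x = p2 (dotv nu x + c * t)
    & forall t x, derive1 (fun s => travelling nu c p s x) t =
                  c * p1 (dotv nu x + c * t)].
Proof.
move=> nu1 dw; have [i i0] := dotv_unit_neq0 nu1.
(* Every real [s] is the phase of the point [s *: nu] at time 0. *)
have dotZ s : dotv nu (s *: nu) + c * 0 = s.
  rewrite mulr0 addr0 -[RHS]mulr1 -nu1 /dotv mulr_sumr; apply: eq_bigr => j _.
  by rewrite !mxE; ring.
have dp s : derivable p s 1.
  have [+ _] := dw 0 (s *: nu) i; rewrite derivable_plane_wave dotZ.
  exact: derivable_direction.
have Dp k : 'D_k p = k \*: 'D_1 p.
  by apply/funext => s; exact: derive_direction.
have dp1 s : derivable ('D_1 p) s 1.
  have [_] := dw 0 (s *: nu) i.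
  rewrite derive_plane_wave derivable_plane_wave dotZ Dp => /(derivable_direction i0).
  move=> dq; have -> : 'D_1 p = (nu ord0 i)^-1 \*: (nu ord0 i \*: 'D_1 p).
    by apply/funext => u /=; rewrite scalerA mulVf // scale1r.
  exact: derivableZ.
exists ('D_1 p), ('D_1 ('D_1 p)); split.
- by move=> s; exact/derivableP.
- by move=> s; exact/derivableP.
- move=> t x; rewrite /laplacian.
  transitivity (dotv nu nu * 'D_1 ('D_1 p) (dotv nu x + c * t)); last first.
    by rewrite nu1 mul1r.
  rewrite [in RHS]/dotv mulr_suml; apply: eq_bigr => j _.
  rewrite (derive_plane_wave nu c t p j) Dp.
  rewrite [LHS](congr1 (fun f => f x) (derive_plane_wave nu c t _ j)) /travelling.
  rewrite derive_direction; last exact: derivableZ.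
  by rewrite deriveZ //= -mulrA.
- move=> t x; rewrite derive1E.
  have dl : is_derive t (1 : R) (fun s => dotv nu x + c * s) c.
    apply: (has_derivative_eq (has_derivativeD (has_derivative_cst _)
      (has_derivativeM (has_derivative_cst c) (fun s => is_derive_id s 1))) _ t).
    by move=> s; rewrite mul0r mulr1 !add0r.
  have dpt : is_derive (dotv nu x + c * t) (1 : R) p ('D_1 p (dotv nu x + c * t)).
    exact/derivableP.
  by have [_ ->] :=
    @is_derive1_comp _ p (fun s => dotv nu x + c * s) t _ _ dpt dl; rewrite mulrC.
Qed.
End PlaneWave.

(** Here [d] stands for the delay [c * h] in the moving frame; its sign is known only once [c] is
    shown to be positive. *)
Record wave_profile (R : realType) (r b c d : R)
    (phi phi1 phi2 theta theta1 theta2 : R -> R) : Prop := WaveProfile {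
  profile_dphi : has_derivative phi phi1;
  profile_dphi1 : has_derivative phi1 phi2;
  profile_dtheta : has_derivative theta theta1;
  profile_dtheta1 : has_derivative theta1 theta2;
  profile_eq_phi : forall t,
    phi2 t = c * phi1 t - phi t * (1 - phi t - r * theta (t - d));
  profile_eq_theta : forall t, theta2 t = c * theta1 t + b * phi t * theta t;
  profile_phi_ninfty : (phi s @[s --> -oo%R] --> (0 : R))%classic;
  profile_theta_ninfty : (theta s @[s --> -oo%R] --> (1 : R))%classic;
  profile_phi_pinfty : (phi s @[s --> +oo%R] --> (1 : R))%classic;
  profile_theta_pinfty : (theta s @[s --> +oo%R] --> (0 : R))%classic;
  profile_phi_gt0 : forall t, 0 < phi t
}.

Lemma wavefront_profile (R : realType) (n : nat) (r b h c : R) (nu : 'rV[R]_n)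
    (phi theta : R -> R) :
  (forall t, 0 < phi t) -> wavefront r b h nu c phi theta ->
  exists phi1 phi2 theta1 theta2,
    wave_profile r b c (c * h) phi phi1 phi2 theta theta1 theta2.
Proof.
move=> phi0 [nu1 [_ _ d2phi d2theta eqphi eqtheta] lphi ltheta mphi mtheta].
have {}nu1 : dotv nu nu = 1.
  have dot0 : 0 <= dotv nu nu by apply: sumr_ge0 => i _; rewrite -expr2 sqr_ge0.
  by rewrite -(sqr_sqrtr dot0) -/(enorm nu) nu1 expr1n.
have [phi1 [phi2 [dphi dphi1 Lphi Tphi]]] := plane_wave_derivatives nu1 d2phi.
have [theta1 [theta2 [dtheta dtheta1 Ltheta Ttheta]]] :=
  plane_wave_derivatives nu1 d2theta.
have dotZ s : dotv nu (s *: nu) = s.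
  rewrite -[RHS]mulr1 -nu1 /dotv mulr_sumr; apply: eq_bigr => j _.
  by rewrite !mxE; ring.
exists phi1, phi2, theta1, theta2; split=> // t.
- have := eqphi 0 (t *: nu); rewrite Lphi Tphi /travelling dotZ mulr0 addr0.
  have -> : t + c * (0 - h) = t - c * h by ring.
  move=> E; lra.
- have := eqtheta 0 (t *: nu); rewrite Ltheta Ttheta /travelling dotZ mulr0 addr0.
  move=> E; lra.
Qed.

(** * Monotonicity of the profile and comparison of its components *)

Lemma cvg_shift_pinfty (R : realType) (f : R -> R) (l d : R) :
  (f s @[s --> +oo%R] --> l)%classic -> (f (s - d) @[s --> +oo%R] --> l)%classic.
Proof. by move=> fl; exact: (cvg_comp _ _ (cvg_addrr (- d)) fl). Qed.

Lemma cvg_shift_ninfty (R : realType) (f : R -> R) (l d : R) :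
  (f s @[s --> -oo%R] --> l)%classic -> (f (s - d) @[s --> -oo%R] --> l)%classic.
Proof. by move=> fl; exact: (cvg_comp _ _ (cvg_addrr_Ny (- d)) fl). Qed.

Section Profile.
Context (R : realType) (r b c d : R) (phi phi1 phi2 theta theta1 theta2 : R -> R).
Context (r0 : 0 < r) (b0 : 0 < b).
Context (P : wave_profile r b c d phi phi1 phi2 theta theta1 theta2).

Let phi_gt0 : forall t, 0 < phi t. Proof. exact: profile_phi_gt0 P. Qed.
Let dphi : has_derivative phi phi1. Proof. exact: profile_dphi P. Qed.
Let dphi1 : has_derivative phi1 phi2. Proof. exact: profile_dphi1 P. Qed.
Let dtheta : has_derivative theta theta1. Proof. exact: profile_dtheta P. Qed.
Let dtheta1 : has_derivative theta1 theta2. Proof. exact: profile_dtheta1 P. Qed.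
Let cphi : continuous phi. Proof. exact: has_derivative_continuous dphi. Qed.
Let ctheta : continuous theta.
Proof. exact: has_derivative_continuous dtheta. Qed.

Lemma theta_ge0 t : 0 <= theta t.
Proof.
apply: (maximum_principle_weak dtheta dtheta1 (profile_theta_ninfty P)
  (profile_theta_pinfty P)) => // s s0 s1.
by rewrite (profile_eq_theta P) s1 mulr0 add0r nmulr_llt0 // mulr_gt0.
Qed.

(** An increase would create an interior maximum with positive value, where [theta2] equals
    [b * phi * theta] and is positive. *)
Lemma theta_nonincr s t : s < t -> theta t <= theta s.
Proof.
move=> st; rewrite leNgt; apply/negP => lt_st.
have t0 : 0 < theta t by apply: le_lt_trans lt_st; exact: theta_ge0.
have [u [su tu umax]] :=
  max_right_half_line ctheta (profile_theta_pinfty P) (ltW st) t0.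
have {}su : s < u.
  rewrite lt_neqAle su andbT; apply/eqP => E.
  by move: lt_st; rewrite ltNge E tu.
have uu : u < u + 1 by lra.
have [u1] := second_derivative_at_max dtheta dtheta1 su uu
  (fun y sy _ => umax y (ltW sy)).
rewrite (profile_eq_theta P) u1 mulr0 add0r leNgt !mulr_gt0 //.
exact: lt_le_trans tu.
Qed.

Lemma theta1_le0 t : theta1 t <= 0.
Proof.
rewrite leNgt; apply/negP => t0.
have /= := @negative_slope_right _ (fun s => - theta s) t (- theta1 t).
case=> [||e e0 He]; [exact: has_derivativeN | by rewrite oppr_lt0 |].
have te : t < t + e / 2 by lra.
have te' : t + e / 2 < t + e by lra.
by have := He _ te te'; rewrite ltrN2 ltNge theta_nonincr.
Qed.

Lemma theta_le1 t : theta t <= 1.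
Proof.
rewrite leNgt; apply/negP => t1.
have [N HN] := gt_lim_ninfty (profile_theta_ninfty P) t1.
have Nt : Num.min N t - 1 < t by rewrite ltrBlDr gt_min; apply/orP; right; lra.
have : Num.min N t - 1 < N by rewrite ltrBlDr gt_min; apply/orP; left; lra.
by move=> /HN; rewrite ltNge theta_nonincr.
Qed.

(** If [c <= 0], both terms of [theta2] are nonnegative, so [theta] is convex; being somewhere
    strictly decreasing, it would be unbounded to the left. *)
Lemma speed_gt0 : 0 < c.
Proof.
rewrite ltNge; apply/negP => c0.
have theta2_ge0 t : 0 <= theta2 t.
  rewrite (profile_eq_theta P) addr_ge0 //; first by rewrite mulr_le0 // theta1_le0.
  by rewrite mulr_ge0 ?theta_ge0 // mulr_ge0 // ltW.
have [t t0] : exists t, theta1 t < 0.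
  have half0 : (0 : R) < 1 / 2 by lra.
  have half1 : (1 / 2 : R) < 1 by lra.
  have [N HN] := lt_lim_ninfty (profile_theta_ninfty P) half1.
  have [M HM] := gt_lim_pinfty (profile_theta_pinfty P) half0.
  have NN : N - 1 < N by lra.
  have MM : M < Num.max M N + 1.
    by rewrite -ltrBlDr lt_max; apply/orP; left; lra.
  have NM : N - 1 < Num.max M N + 1.
    by rewrite -ltrBlDr lt_max; apply/orP; right; lra.
  have [z [_ _ fz]] := mean_value dtheta NM.
  exists z; rewrite -(pmulr_llt0 _ (x := Num.max M N + 1 - (N - 1))).
    by rewrite -fz subr_lt0; apply: lt_trans (HM _ MM) (HN _ NN).
  by rewrite subr_gt0.
pose k := - theta1 t.
have k0 : 0 < k by rewrite oppr_gt0.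
(* Left of [t] the slope is at most [- k], so over a length [2 / k] the function drops by at least
   2, although its values lie between 0 and 1. *)
have sk : 0 < 2 / k by rewrite divr_gt0.
have st : t - 2 / k < t by lra.
have [z [_ zt fz]] := mean_value dtheta st.
have [y [_ _ fy]] := mean_value dtheta1 zt.
have zle : theta1 z <= theta1 t.
  by rewrite -subr_ge0 fy mulr_ge0 // subr_ge0 ltW.
have : theta1 z * (t - (t - 2 / k)) <= theta1 t * (t - (t - 2 / k)).
  by rewrite ler_wpM2r // subr_ge0 ltW.
rewrite -fz subKr.
have -> : theta1 t * (2 / k) = - 2.
  by rewrite -[theta1 t]opprK -/k mulNr mulrC divfK // gt_eqF.
have := theta_le1 (t - 2 / k); have := theta_ge0 t; lra.
Qed.

Lemma phi_le1 t : phi t <= 1.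
Proof.
rewrite -subr_ge0.
have dw : has_derivative (fun s => 1 - phi s) (fun s => - phi1 s).
  apply: (has_derivative_eq (has_derivativeD (has_derivative_cst 1)
    (has_derivativeN dphi))) => s; exact: add0r.
apply: (maximum_principle_weak dw (has_derivativeN dphi1) (l := 1 - 0)
  (m := 1 - 1)).
- by apply: cvgB; [exact: cvg_cst | exact: profile_phi_ninfty P].
- by apply: cvgB; [exact: cvg_cst | exact: profile_phi_pinfty P].
- lra.
- lra.
move=> s s0 /eqP; rewrite oppr_eq0 => /eqP s1.
rewrite (profile_eq_phi P) s1 mulr0 sub0r opprK pmulr_rlt0 //.
have := mulr_ge0 (ltW r0) (theta_ge0 (s - d)); lra.
Qed.

(* Backward uniqueness: a zero of theta, being a minimum, is a zero of the energy
   theta^2 + theta'^2, whose logarithmic derivative is at least - (1 + b). *)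
Lemma theta_gt0 t : 0 < theta t.
Proof.
rewrite lt_def theta_ge0 andbT; apply/eqP => t0.
have tl : t - 1 < t by lra.
have tr : t < t + 1 by lra.
have [t1 _] : theta1 t = 0 /\ 0 <= theta2 t.
  apply: (second_derivative_at_min dtheta dtheta1 tl tr) => s _ _.
  by rewrite t0 theta_ge0.
pose E s := theta s * theta s + theta1 s * theta1 s.
pose E1 s := (theta1 s * theta s + theta s * theta1 s) +
  (theta2 s * theta1 s + theta1 s * theta2 s).
have dE : has_derivative E E1.
  by apply: has_derivativeD; exact: has_derivativeM.
(* With this integrating factor the energy becomes nondecreasing, so it cannot pass from a positive
   value at some [s < t] to 0 at [t]. *)
have dexp : has_derivative (fun s => expR ((1 + b) * s))
    (fun s => expR ((1 + b) * s) * (1 + b)).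
  move=> s; apply: (@is_derive1_comp _ expR (fun s => (1 + b) * s)).
  apply: (has_derivative_eq (has_derivativeM (has_derivative_cst (1 + b))
    (fun s => is_derive_id s 1))) => u; by rewrite mul0r mulr1 add0r.
have dG := has_derivativeM dE dexp.
have half1 : (1 / 2 : R) < 1 by lra.
have [N HN] := lt_lim_ninfty (profile_theta_ninfty P) half1.
pose s := Num.min N t - 1.
have sN : s < N by rewrite ltrBlDr gt_min; apply/orP; left; lra.
have st : s < t by rewrite ltrBlDr gt_min; apply/orP; right; lra.
have [z [_ _]] := mean_value dG st.
have Et : E t = 0 by rewrite /E t0 t1 !mulr0 addr0.
rewrite Et mul0r sub0r => fz.
have Es : 0 < E s.
  rewrite /E; have := HN _ sN; have := sqr_ge0 (theta1 s); rewrite expr2; nra.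
have : 0 <= (E1 z * expR ((1 + b) * z) + E z * (expR ((1 + b) * z) * (1 + b))).
  have -> : E1 z * expR ((1 + b) * z) + E z * (expR ((1 + b) * z) * (1 + b)) =
    expR ((1 + b) * z) * (E1 z + (1 + b) * E z) by ring.
  rewrite mulr_ge0 ?expR_ge0 // /E1 /E (profile_eq_theta P).
  (* Completing the square shows the sign: the coefficients are nonnegative because [c > 0] and
     [0 < phi <= 1]. *)
  have -> : theta1 z * theta z + theta z * theta1 z +
    ((c * theta1 z + b * phi z * theta z) * theta1 z +
     theta1 z * (c * theta1 z + b * phi z * theta z)) +
    (1 + b) * (theta z * theta z + theta1 z * theta1 z) =
    2 * c * theta1 z ^+ 2 + (1 + b * phi z) * (theta z + theta1 z) ^+ 2 +
    b * (1 - phi z) * (theta z ^+ 2 + theta1 z ^+ 2) by ring.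
  have c0 := ltW speed_gt0; have p0 := ltW (phi_gt0 z); have bb := ltW b0.
  rewrite !addr_ge0 // mulr_ge0 ?addr_ge0 ?sqr_ge0 ?mulr_ge0 ?ler01 //.
  by rewrite subr_ge0 phi_le1.
move=> /mulr_ge0 /(_ (ltW (_ : 0 < t - s))); rewrite subr_gt0 => /(_ st).
rewrite -fz oppr_ge0 leNgt mulr_gt0 //; exact: expR_gt0.
Qed.

(** A zero of [theta1] would be a maximum of it, hence a zero of [theta2]; but there [theta2] equals
    [b * phi * theta], which is positive. *)
Lemma theta1_lt0 t : theta1 t < 0.
Proof.
rewrite lt_def theta1_le0 andbT; apply/eqP => t1.
have D0 : is_derive t (1 : R) theta1 0.
  have tl : t - 1 <= t + 1 by lra.
  apply: (derive1_at_max tl); first by move=> s _; case: (dtheta1 s).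
    by rewrite in_itv /=; apply/andP; split; lra.
  by move=> s _; rewrite -t1 theta1_le0.
have : theta2 t = 0 by case: (dtheta1 t) => _ <-; case: D0.
rewrite (profile_eq_theta P) -t1 mulr0 add0r => /eqP; apply/negP.
by rewrite gt_eqF // mulr_gt0 ?theta_gt0 // mulr_gt0.
Qed.

Lemma theta_decr s t : s < t -> theta t < theta s.
Proof.
move=> st; have [z [_ _ fz]] := mean_value dtheta st.
by rewrite -subr_lt0 fz pmulr_llt0 ?subr_gt0 // theta1_lt0.
Qed.

(* At a local maximum 1 - phi - r theta(. - d) is nonnegative, at a local minimum it
   is nonpositive, while theta strictly decreases in between. *)
Lemma phi_max_lt_min (x1 y1 s x2 y2 t : R) :
  x1 < s -> s < y1 -> (forall u, x1 < u -> u < y1 -> phi u <= phi s) ->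
  x2 < t -> t < y2 -> (forall u, x2 < u -> u < y2 -> phi t <= phi u) ->
  s < t -> phi s < phi t.
Proof.
move=> x1s sy1 smax x2t ty2 tmin st; rewrite ltNge; apply/negP => pts.
have [s1 s2] := second_derivative_at_max dphi dphi1 x1s sy1 smax.
have [t1 t2] := second_derivative_at_min dphi dphi1 x2t ty2 tmin.
have std : s - d < t - d by rewrite ltrD2r.
move: s2 t2; rewrite !(profile_eq_phi P) s1 t1 mulr0 !sub0r oppr_le0 oppr_ge0.
rewrite (pmulr_rge0 _ (phi_gt0 s)) (pmulr_rle0 _ (phi_gt0 t)) => s2 t2.
have : r * theta (t - d) < r * theta (s - d) by rewrite ltr_pM2l // theta_decr.
lra.
Qed.

(** A decrease yields a minimum [u] over the half line right of [s], then a maximum [v] over the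
    half line left of [u]. These are a local maximum followed by a lower local minimum, against
    [phi_max_lt_min]. *)
Lemma phi_nondecr s t : s < t -> phi s <= phi t.
Proof.
move=> st; rewrite leNgt; apply/negP => lt_ts.
have t1 : phi t < 1 by apply: lt_le_trans (phi_le1 s).
have [u [su ut umin]] :=
  min_right_half_line cphi (profile_phi_pinfty P) (ltW st) t1.
have lt_us := le_lt_trans ut lt_ts.
have {}su : s < u.
  by rewrite lt_neqAle su andbT; apply: contraTneq lt_us => ->; rewrite ltxx.
have [v [vu sv vmax]] :=
  max_left_half_line cphi (profile_phi_ninfty P) (ltW su) (phi_gt0 s).
have lt_uv := lt_le_trans lt_us sv.
have {}vu : v < u.
  by rewrite lt_neqAle vu andbT; apply: contraTneq lt_uv => ->; rewrite ltxx.
have vl : v - 1 < v by lra.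
have ur : u < u + 1 by lra.
have := phi_max_lt_min vl vu (fun y _ yu => vmax y (ltW yu))
  su ur (fun y sy _ => umin y (ltW sy)) vu.
by rewrite ltNge (ltW lt_uv).
Qed.

(** On an interval of constancy every interior point is both a local maximum and a local minimum, so
    two such points contradict [phi_max_lt_min]. *)
Lemma phi_incr s t : s < t -> phi s < phi t.
Proof.
move=> st; rewrite lt_neqAle phi_nondecr // andbT; apply/eqP => E.
have cst u : s < u -> u < t -> phi u = phi s.
  move=> su ut; apply/eqP; rewrite eq_le (phi_nondecr su) andbT E.
  exact: phi_nondecr.
pose u := s + (t - s) / 3; pose v := s + (t - s) * 2 / 3.
have [su uv vt] : [/\ s < u, u < v & v < t] by rewrite /u /v; split; lra.
have ut := lt_trans uv vt; have sv := lt_trans su uv.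
have : phi u < phi v.
  by apply: (phi_max_lt_min su ut _ sv vt _ uv) => y sy yt; rewrite !cst.
by rewrite !cst // ltxx.
Qed.

Lemma phi_delay_le t : 0 <= d -> phi (t - d) <= phi t.
Proof.
rewrite le_eqVlt => /orP[/eqP <-|d0]; first by rewrite subr0.
by apply: phi_nondecr; lra.
Qed.

Lemma phi_delay_lt t : 0 < d -> phi (t - d) < phi t.
Proof. by move=> d0; apply: phi_incr; lra. Qed.

(** * Comparison of [phi] and [psi] by the maximum principle *)

Let psi t := 1 - theta (t - d).
Let psi1 t := - theta1 (t - d).
Let psi2 t := - theta2 (t - d).

Let dpsi : has_derivative psi psi1.
Proof.
apply: (has_derivative_eq (has_derivativeD (has_derivative_cst 1)
  (has_derivativeN (has_derivative_shift d dtheta)))) => t; exact: add0r.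
Qed.

Let dpsi1 : has_derivative psi1 psi2.
Proof. exact: has_derivativeN (has_derivative_shift d dtheta1). Qed.

(** The shift in [psi] absorbs the delay of the equation for [phi]; the delay survives only in the
    factor [phi (t - d)] here, and monotonicity controls it. *)
Let eq_psi t : psi2 t = c * psi1 t - b * phi (t - d) * (1 - psi t).
Proof. by rewrite /psi2 /psi1 /psi (profile_eq_theta P); ring. Qed.

Let eq_phi t : phi2 t = c * phi1 t - phi t * (1 - r - phi t + r * psi t).
Proof. by rewrite (profile_eq_phi P) /psi; ring. Qed.

Let psi_ninfty : (psi s @[s --> -oo%R] --> (1 - 1 : R))%classic.
Proof.
apply: cvgB; first exact: cvg_cst.
exact/cvg_shift_ninfty/(profile_theta_ninfty P).
Qed.

Let psi_pinfty : (psi s @[s --> +oo%R] --> (1 - 0 : R))%classic.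
Proof.
apply: cvgB; first exact: cvg_cst.
exact/cvg_shift_pinfty/(profile_theta_pinfty P).
Qed.

Let psi_lt1 t : psi t < 1.
Proof. by rewrite ltrBlDr ltrDl theta_gt0. Qed.

Let psi_ge0 t : 0 <= psi t.
Proof. by rewrite subr_ge0 theta_le1. Qed.

Let psi_incr s t : s < t -> psi s < psi t.
Proof. by move=> st; rewrite ltrD2l ltrN2 theta_decr // ltrD2r. Qed.

Let cvgZ (F : set_system R) (FF : Filter F) (f : R -> R) (k l : R) :
  (f s @[s --> F] --> l)%classic -> (k * f s @[s --> F] --> k * l)%classic.
Proof. by move=> fl; apply: cvgM => //; exact: cvg_cst. Qed.

Let dZ (k : R) (f f' : R -> R) : has_derivative f f' ->
  has_derivative (fun t => k * f t) (fun t => k * f' t).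
Proof.
move=> df; apply: (has_derivative_eq (has_derivativeM (has_derivative_cst k) df)).
by move=> t; rewrite mul0r add0r.
Qed.

Let dB (f f' g g' : R -> R) : has_derivative f f' -> has_derivative g g' ->
  has_derivative (fun t => f t - g t) (fun t => f' t - g' t).
Proof. by move=> df dg; exact: has_derivativeD (has_derivativeN dg). Qed.

(** Where the difference is nonpositive, [phi <= K * phi <= psi]. The reaction terms split into
    three nonnegative ones, due to the delay, to [b <= K * (1 - r)] and to [phi <= psi]. *)
Lemma psi_lt_phi (K : R) : 0 <= d -> r < 1 -> 1 <= K -> b <= K * (1 - r) ->
  0 < d \/ b + r <> 1 \/ 1 < K -> forall t, psi t < K * phi t.
Proof.
move=> d0 r1 K1 bK strict t; rewrite -subr_gt0.
have phid := phi_delay_le ^~ d0.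
apply: (maximum_principle (dB (dZ K dphi) dpsi) (dB (dZ K dphi1) dpsi1)
  (l := K * 0 - (1 - 1)) (m := K * 1 - (1 - 0))).
- by apply: cvgB => //; apply: cvgZ; exact: profile_phi_ninfty P.
- by apply: cvgB => //; apply: cvgZ; exact: profile_phi_pinfty P.
- lra.
- lra.
move=> {}t t0 t1.
rewrite eq_phi eq_psi.
have p0 := phi_gt0 t.
have q0 : 0 < 1 - psi t by rewrite subr_gt0.
have -> : K * (c * phi1 t - phi t * (1 - r - phi t + r * psi t)) -
  (c * psi1 t - b * phi (t - d) * (1 - psi t)) =
  c * (K * phi1 t - psi1 t) -
  (b * (phi t - phi (t - d)) * (1 - psi t) +
   phi t * (K * (1 - r) - b) * (1 - psi t) + K * phi t * (psi t - phi t)) by ring.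
rewrite t1 mulr0 sub0r oppr_lt0.
have KP : phi t <= K * phi t by rewrite ler_peMl // ltW.
have psiphi : phi t <= psi t by lra.
have T1 : 0 <= b * (phi t - phi (t - d)) * (1 - psi t).
  apply: mulr_ge0 (ltW q0); apply: mulr_ge0 (ltW b0) _; rewrite subr_ge0; exact: phid.
have T2 : 0 <= phi t * (K * (1 - r) - b) * (1 - psi t).
  by apply: mulr_ge0 (ltW q0); apply: mulr_ge0 (ltW p0) _; rewrite subr_ge0.
have T3 : 0 <= K * phi t * (psi t - phi t).
  by apply: mulr_ge0; [apply: le_trans KP; exact: ltW | rewrite subr_ge0].
(* Each alternative of [strict] makes one term positive: [1 < K] the third, [0 < d] the first, and
   [b + r <> 1] with [K = 1] the second. *)
have [K1'|K1'] := boolP (1 < K).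
  suff : 0 < K * phi t * (psi t - phi t) by lra.
  have KP' : phi t < K * phi t by rewrite ltr_pMl.
  by apply: mulr_gt0; [apply: lt_trans KP' | rewrite subr_gt0; lra].
have {K1'} K1' : K = 1 by apply/eqP; rewrite eq_le K1 andbT leNgt.
case: strict => [dgt0|[br|K1'']]; last by move: K1''; rewrite K1' ltxx.
  suff : 0 < b * (phi t - phi (t - d)) * (1 - psi t) by lra.
  by rewrite mulr_gt0 // mulr_gt0 // subr_gt0 phi_delay_lt.
suff : 0 < phi t * (K * (1 - r) - b) * (1 - psi t) by lra.
rewrite mulr_gt0 // mulr_gt0 // subr_gt0 lt_neqAle bK andbT.
by apply/eqP => E; apply: br; move: E; rewrite K1'; lra.
Qed.

(** The mirror argument, with the equation for [phi] taken at [t - d]: the delay now enters through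
    the monotonicity of [psi]. *)
Lemma phi_delay_lt_psi (L : R) : 0 <= d -> r < 1 -> 0 < L -> L <= 1 ->
  L * (1 - r) <= b -> 0 < d \/ b + r <> 1 \/ L < 1 ->
  forall t, L * phi (t - d) < psi t.
Proof.
move=> d0 r1 L0 L1 bL strict t; rewrite -subr_gt0.
have dp := has_derivative_shift d dphi.
have dp1 := has_derivative_shift d dphi1.
apply: (maximum_principle (dB dpsi (dZ L dp)) (dB dpsi1 (dZ L dp1))
  (l := (1 - 1) - L * 0) (m := (1 - 0) - L * 1)).
- by apply: cvgB => //; apply: cvgZ; exact/cvg_shift_ninfty/(profile_phi_ninfty P).
- by apply: cvgB => //; apply: cvgZ; exact/cvg_shift_pinfty/(profile_phi_pinfty P).
- lra.
- lra.
move=> {}t t0 t1.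
rewrite eq_phi eq_psi.
set p := phi (t - d); have p0 : 0 < p by exact: phi_gt0.
have q0 : 0 < 1 - psi t by rewrite subr_gt0.
have -> : c * psi1 t - b * p * (1 - psi t) -
  L * (c * phi1 (t - d) - p * (1 - r - p + r * psi (t - d))) =
  c * (psi1 t - L * phi1 (t - d)) -
  p * ((b - L * (1 - r)) * (1 - psi t) + L * (p - psi t) +
       L * r * (psi t - psi (t - d))) by ring.
rewrite t1 mulr0 sub0r oppr_lt0 pmulr_rgt0 //.
have psid : psi (t - d) <= psi t.
  move: d0; rewrite le_eqVlt => /orP[/eqP <-|d0]; first by rewrite subr0.
  by apply/ltW/psi_incr; lra.
have LP : L * p <= p by rewrite ger_pMl.
rewrite -/p in t0.
have T1 : 0 <= (b - L * (1 - r)) * (1 - psi t).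
  by apply: mulr_ge0 (ltW q0); rewrite subr_ge0.
have T2 : 0 <= L * (p - psi t) by apply: mulr_ge0 (ltW L0) _; lra.
have T3 : 0 <= L * r * (psi t - psi (t - d)).
  by rewrite mulr_ge0 ?subr_ge0 // ltW // mulr_gt0.
have [L1'|L1'] := boolP (L < 1).
  suff : 0 < L * (p - psi t) by lra.
  have LP' : L * p < p by rewrite gtr_pMl.
  by rewrite mulr_gt0 // subr_gt0; lra.
have {L1'} L1' : L = 1 by apply/eqP; rewrite eq_le L1 leNgt.
case: strict => [dgt0|[br|L1'']]; last by move: L1''; rewrite L1' ltxx.
  suff : 0 < L * r * (psi t - psi (t - d)) by lra.
  by rewrite mulr_gt0 ?subr_gt0 ?psi_incr //; [rewrite mulr_gt0 | lra].
suff : 0 < (b - L * (1 - r)) * (1 - psi t) by lra.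
rewrite mulr_gt0 // subr_gt0 lt_neqAle bL andbT.
by apply/eqP => E; apply: br; move: E; rewrite L1'; lra.
Qed.

(** Strictness comes from [b * phi (t - d) * (1 - psi t)], which is always positive; the other terms
    are nonnegative by [1 <= r], [phi <= 1] and [psi <= phi] at the point considered. *)
Lemma phi_lt_psi : 1 <= r -> forall t, phi t < psi t.
Proof.
move=> r1 t; rewrite -subr_gt0.
apply: (maximum_principle (dB dpsi dphi) (dB dpsi1 dphi1)
  (l := (1 - 1) - 0) (m := (1 - 0) - 1)).
- by apply: cvgB => //; exact: profile_phi_ninfty P.
- by apply: cvgB => //; exact: profile_phi_pinfty P.
- lra.
- lra.
move=> {}t t0 t1; rewrite eq_phi eq_psi.
have -> : c * psi1 t - b * phi (t - d) * (1 - psi t) -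
  (c * phi1 t - phi t * (1 - r - phi t + r * psi t)) =
  c * (psi1 t - phi1 t) - (b * phi (t - d) * (1 - psi t) +
  phi t * ((r - 1) * (1 - phi t) + r * (phi t - psi t))) by ring.
rewrite t1 mulr0 sub0r oppr_lt0 ltr_wpDr //.
  apply: mulr_ge0 (ltW (phi_gt0 t)) _; apply: addr_ge0; apply: mulr_ge0.
  - by rewrite subr_ge0.
  - by rewrite subr_ge0 phi_le1.
  - exact: ltW.
  - lra.
by rewrite mulr_gt0 ?subr_gt0 // mulr_gt0.
Qed.

(** Differentiating the square twice yields [2 * psi1 ^+ 2], positive because [theta] has no
    critical point; this gives strictness. The bound [2 * b <= M] absorbs the reaction term of
    [psi], and [1 <= M] gives [phi <= psi ^+ 2] at the point considered. *)
Lemma psi_sqr_lt (M : R) : 0 <= d -> r <= 1 -> 1 <= M -> 2 * b <= M ->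
  forall t, psi t ^+ 2 < M * phi t.
Proof.
move=> d0 r1 M1 bM t; rewrite -subr_gt0 expr2.
have dS := has_derivativeM dpsi dpsi.
have dS1 := has_derivativeD (has_derivativeM dpsi1 dpsi)
  (has_derivativeM dpsi dpsi1).
apply: (maximum_principle (dB (dZ M dphi) dS) (dB (dZ M dphi1) dS1)
  (l := M * 0 - (1 - 1) * (1 - 1)) (m := M * 1 - (1 - 0) * (1 - 0))).
- by apply: cvgB; [apply: cvgZ; exact: profile_phi_ninfty P | exact: cvgM].
- by apply: cvgB; [apply: cvgZ; exact: profile_phi_pinfty P | exact: cvgM].
- lra.
- lra.
move=> {}t t0 t1; rewrite eq_phi eq_psi.
have p0 := phi_gt0 t.
have q0 : 0 < 1 - psi t by rewrite subr_gt0.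
set p := phi t in p0 t0 *; set q := psi t in q0 t0 t1 *; set e := phi (t - d).
have -> : M * (c * phi1 t - p * (1 - r - p + r * q)) -
  ((c * psi1 t - b * e * (1 - q)) * q + psi1 t * psi1 t +
   (psi1 t * psi1 t + q * (c * psi1 t - b * e * (1 - q)))) =
  c * (M * phi1 t - (psi1 t * q + q * psi1 t)) -
  (2 * psi1 t ^+ 2 + 2 * b * (p - e) * q * (1 - q) +
   (M - 2 * b) * p * q * (1 - q) +
   M * p * ((1 - r) * (1 - q) + (q * q - p))) by ring.
rewrite t1 mulr0 sub0r oppr_lt0.
have psi1gt0 : 0 < psi1 t by rewrite oppr_gt0 theta1_lt0.
have ep : e <= p by exact: phi_delay_le.
have qq0 : 0 <= q by exact: psi_ge0.
have MP : p <= M * p by rewrite ler_peMl // ltW.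
have T1 : 0 < 2 * psi1 t ^+ 2 by rewrite mulr_gt0 // exprn_gt0.
have T2 : 0 <= 2 * b * (p - e) * q * (1 - q).
  apply: mulr_ge0 (ltW q0); apply: mulr_ge0 qq0; rewrite mulr_ge0 ?subr_ge0 //.
  by rewrite mulr_ge0 // ltW.
have T3 : 0 <= (M - 2 * b) * p * q * (1 - q).
  by apply: mulr_ge0 (ltW q0); rewrite mulr_ge0 // mulr_ge0 ?subr_ge0 // ltW.
have T4 : 0 <= M * p * ((1 - r) * (1 - q) + (q * q - p)).
  apply: mulr_ge0; first by lra.
  by apply: addr_ge0; [rewrite mulr_ge0 ?subr_ge0 // ltW // -subr_gt0 | lra].
lra.
Qed.

End Profile.

(** The disjunctions guarding the strict bounds exclude exactly [h = 0], [b + r = 1] with [L = 1],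
    respectively [K = 1]: there [phi] and [psi] coincide, so strictness fails. *)
Theorem theorem6 (R : realType) (n : nat) (r b h c : R) (nu : 'rV[R]_n)
    (phi theta : R -> R)
    (hr : 0 < r) (hb : 0 < b) (hh : 0 <= h)
    (hphi : forall t : R, 0 < phi t)
    (hwf : wavefront r b h nu c phi theta) :
  let psi : R -> R := fun t => 1 - theta (t - c * h) in
  [/\ r < 1 ->
        (forall K L : R, 1 <= K -> 0 < L -> L <= 1 ->
           L <= b / (1 - r) -> b / (1 - r) <= K ->
           forall t : R,
             (0 < h \/ b + r <> 1 \/ L < 1 -> L * phi (t - c * h) < psi t) /\
             (0 < h \/ b + r <> 1 \/ 1 < K -> psi t < K * phi t)) /\
        (b + r = 1 ->
           (forall t : R, phi (t - c * h) <= psi t /\ psi t <= phi t) /\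
           (h = 0 -> forall t : R, phi t = psi t)),
      1 <= r -> forall t : R, phi t < psi t
    & r <= 1 -> forall t : R, psi t ^+ 2 < Num.max 1 (2 * b) * phi t].
Proof.
move=> psi.
have [phi1 [phi2 [theta1 [theta2 P]]]] := wavefront_profile hphi hwf.
have c0 : 0 < c := speed_gt0 hb P.
have d0 : 0 <= c * h by rewrite mulr_ge0 // ltW.
have d_gt0 (X : Prop) : 0 < h \/ X -> 0 < c * h \/ X.
  by case=> [h0|]; [left; rewrite mulr_gt0 | right].
split=> [r1|r1 t|r1 t]; last 2 first.
- exact: (phi_lt_psi hr hb P).
- by apply: (psi_sqr_lt hr hb P) => //; rewrite le_max lexx ?orbT.
have r1' : 0 < 1 - r by rewrite subr_gt0.
have bounds K L : 1 <= K -> 0 < L -> L <= 1 ->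
    L <= b / (1 - r) -> b / (1 - r) <= K -> forall t : R,
    (0 < h \/ b + r <> 1 \/ L < 1 -> L * phi (t - c * h) < psi t) /\
    (0 < h \/ b + r <> 1 \/ 1 < K -> psi t < K * phi t).
  rewrite ler_pdivlMr // ler_pdivrMr // => K1 L0 L1 Lb bK t.
  split=> /d_gt0 s.
  - exact: (phi_delay_lt_psi hr hb P).
  - exact: (psi_lt_phi hr hb P).
split=> // br.
have br1 : b / (1 - r) = 1.
  have -> : b = 1 - r by lra.
  by rewrite divff // gt_eqF.
(* The strict bounds hold for [L = 1 / (1 + e)] and [K = 1 + e]; since [psi < 1] and [phi <= 1], the
   error is at most [e], which is arbitrary. *)
have weak t : phi (t - c * h) <= psi t /\ psi t <= phi t.
  split; apply/ler_addgt0Pr => e e0.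
  - pose L := (1 + e)^-1.
    have e1 : 0 < 1 + e by lra.
    have L0 : 0 < L by rewrite invr_gt0.
    have L1 : L < 1 by rewrite invf_lt1 //; lra.
    have Lb : L <= b / (1 - r) by rewrite br1 ltW.
    have bK : b / (1 - r) <= 1 by rewrite br1.
    have := (bounds 1 L (lexx 1) L0 (ltW L1) Lb bK t).1 (or_intror (or_intror L1)).
    rewrite mulrC ltr_pdivrMr // => H.
    have : psi t < 1 by rewrite ltrBlDr ltrDl (theta_gt0 hr hb P).
    nra.
  - have e1 : 1 < 1 + e by lra.
    have Lb : 1 <= b / (1 - r) by rewrite br1.
    have bK : b / (1 - r) <= 1 + e by rewrite br1 ltW.
    have H := (bounds (1 + e) 1 (ltW e1) ltr01 (lexx 1) Lb bK t).2
      (or_intror (or_intror e1)).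
    have := phi_le1 hr hb P t; have := hphi t; nra.
split=> // h0 t; have [+ ] := weak t.
by rewrite {1}h0 mulr0 subr0 => p1 p2; apply/eqP; rewrite eq_le p1.
Qed.
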